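(* Let $\mathbb{X}$ be a two-dimensional (real) polyhedral Banach space and let $\mathbb{Y}$ be a finite-dimensional (real) polyhedral Banach space. Then the pair $(\mathbb{X},\mathbb{Y})$ satisfies the rank invariant Krein-Milman Property of order $1$.
   Context: All Banach spaces are real. A finite-dimensional Banach space $\mathbb{X}$ is polyhedral if its closed unit ball $B_{\mathbb{X}}$ has finitely many extreme points; in other words, $B_{\mathbb{X}}$ is a polyhedron in $\mathbb{R}^n$ for some natural number $n\ge 2$. $\mathbb{L}(\mathbb{X},\mathbb{Y})$ is the space of bounded linear operators from $\mathbb{X}$ to $\mathbb{Y}$ with the operator norm. An extreme contraction is an extreme point of the unit ball of $\mathbb{L}(\mathbb{X},\mathbb{Y})$. For $r\in\mathbb{N}$, the pair $(\mathbb{X},\mathbb{Y})$ satisfies the rank invariant Krein-Milman Property of order $r$ if every norm one linear operator in $\mathbb{L}(\mathbb{X},\mathbb{Y})$ having rank $r$ can be expressed as a convex combination of extreme contractions in $\mathbb{L}(\mathbb{X},\mathbb{Y})$ having rank $r$. *)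

(* Defs.v *)
From HB Require Import structures.
From mathcomp Require Import all_boot all_order all_algebra.
From mathcomp Require Import all_classical all_reals all_analysis.

Set Implicit Arguments.
Unset Strict Implicit.
Unset Printing Implicit Defensive.

Import Order.TTheory GRing.Theory Num.Theory.
Import numFieldNormedType.Exports.

Local Open Scope classical_set_scope.
Local Open Scope ring_scope.

#[short(type="finDimBanachType")]
HB.structure Definition FinDimBanach (K : numFieldType) :=
  {V of CompleteNormedModule K V & Vector K V}.

Definition extreme_points (R : realType) (V : lmodType R) (A : set V) : set V :=
  [set x | A x /\ forall (y z : V) (t : R), A y -> A z -> 0 < t < 1 ->
     x = t *: y + (1 - t) *: z -> y = x /\ z = x].

Definition convex_combinations (R : realType) (V : lmodType R) (A : set V) :
    set V :=
  [set x | exists (n : nat) (c : 'I_n -> R) (a : 'I_n -> V),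
     [/\ forall i, 0 <= c i, \sum_i c i = 1, forall i, A (a i) &
         x = \sum_i c i *: a i]].

Definition unit_ball (R : realType) (V : normedModType R) : set V :=
  [set x | `|x| <= 1].
Arguments unit_ball {R} V.

Definition polyhedral (R : realType) (V : finDimBanachType R) : Prop :=
  finite_set (extreme_points (unit_ball V)).

(* Linear maps between finite-dimensional normed spaces are all bounded, so
   'Hom(X, Y) is the whole space of bounded operators. The supremum is taken
   in \bar R so that it needs no boundedness proof to be meaningful. *)
Definition opnorm (R : realType) (X Y : finDimBanachType R) (T : 'Hom(X, Y)) :
    \bar R :=
  ereal_sup [set (`|T x|)%:E | x in unit_ball X].

Definition extreme_contractions (R : realType) (X Y : finDimBanachType R) :
    set 'Hom(X, Y) :=
  extreme_points [set T : 'Hom(X, Y) | (opnorm T <= 1)%E].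
Arguments extreme_contractions {R} X Y.

Definition rank (R : realType) (X Y : finDimBanachType R) (T : 'Hom(X, Y)) :
    nat :=
  \dim (limg T).

Definition rank_invariant_KMP (R : realType) (X Y : finDimBanachType R)
    (r : nat) : Prop :=
  forall T : 'Hom(X, Y), opnorm T = 1%E -> rank T = r ->
    convex_combinations
      (extreme_contractions X Y `&` [set S | rank S = r]) T.

(* Main.v *)
Require Import Defs.
From HB Require Import structures.
From mathcomp Require Import all_boot all_order all_algebra.
From mathcomp Require Import all_classical all_reals all_analysis.
From mathcomp Require Import ring lra.

Set Implicit Arguments.
Unset Strict Implicit.
Unset Printing Implicit Defensive.

Import Order.TTheory GRing.Theory Num.Theory.
Import numFieldNormedType.Exports.

Local Open Scope classical_set_scope.
Local Open Scope ring_scope.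

(** A norm one operator of rank one is [f (x) y : x |-> f x *: y] with [f] in the
    dual ball of the domain and [y] in the unit ball of the codomain. Expanding
    [f] and [y] as convex combinations of extreme points of their respective
    balls and multiplying out gives a convex combination of operators
    [f_i (x) y_j] with [f_i] and [y_j] extreme and nonzero, so everything rests
    on two facts.

    The first is Minkowski's theorem, [minkowski]: in finite dimension each
    point of these balls is a convex combination of extreme points. It is
    applied to the unit balls of both spaces and to the dual ball.

    The second, [tensor_extreme], is that [f (x) y] is an extreme contraction
    when [f] and [y] are extreme. Since the domain is polyhedral, an extreme [f]
    equals 1 on a set of unit vectors that spans the domain
    ([extreme_functional_norming_span]: extreme functionals correspond to the
    facets of the ball). On those vectors the operator takes the extreme value
    [y], which leaves no freedom to a convex decomposition. *)

(** * Convex combinations *)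

Lemma convex_combinationsI (R : realType) (V : lmodType R) (A : set V)
    (I : finType) (c : I -> R) (a : I -> V) :
    (forall i, 0 <= c i) -> \sum_i c i = 1 -> (forall i, A (a i)) ->
  convex_combinations A (\sum_i c i *: a i).
Proof.
move=> c_ge0 sum_c Aa.
exists #|I|, (c \o enum_val), (a \o enum_val).
split=> [i||i|] /=; [exact: c_ge0| |exact: Aa|].
  by rewrite -sum_c -(big_enum_val c).
by rewrite -(big_enum_val (fun i => c i *: a i)).
Qed.

Lemma convex_combinations1 (R : realType) (V : lmodType R) (A : set V) (x : V) :
  A x -> convex_combinations A x.
Proof.
move=> Ax; exists 1%N, (fun=> 1), (fun=> x).
by split=> //; rewrite big_ord1 ?scale1r.
Qed.

Lemma convex_combinations_segment (R : realType) (V : lmodType R) (A : set V)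
    (x y : V) (t : R) : 0 <= t <= 1 ->
  convex_combinations A x -> convex_combinations A y ->
  convex_combinations A (t *: x + (1 - t) *: y).
Proof.
move=> /andP[t0 t1] [n [c [a [c0 c1 Aa ->]]]] [m [d [b [d0 d1 Ab ->]]]].
pose w (k : 'I_n + 'I_m) :=
  match k with inl i => t * c i | inr j => (1 - t) * d j end.
pose p (k : 'I_n + 'I_m) := match k with inl i => a i | inr j => b j end.
have -> : t *: (\sum_i c i *: a i) + (1 - t) *: (\sum_i d i *: b i) =
    \sum_k w k *: p k.
  rewrite big_sumType /= !scaler_sumr.
  by congr (_ + _); apply: eq_bigr => i _; rewrite scalerA.
apply: convex_combinationsI => [[i|j]||[i|j]] //=.
- exact: mulr_ge0.
- by rewrite mulr_ge0 ?subr_ge0.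
- by rewrite big_sumType /= -!mulr_sumr c1 d1 !mulr1 addrC subrK.
Qed.

(** * Minkowski's theorem, by induction on the dimension of a face *)

Definition convex_set (R : realType) (V : lmodType R) (A : set V) : Prop :=
  forall (x y : V) (t : R), A x -> A y -> 0 <= t <= 1 ->
    A (t *: x + (1 - t) *: y).

(** The only form of compactness that is used: every line that meets [A] has a
    last point in [A], in either direction since [v] may be negated. *)
Definition has_exit_points (R : realType) (V : lmodType R) (A : set V) : Prop :=
  forall x v : V, A x -> v != 0 ->
    exists2 s : R, A (x + s *: v) & forall r, s < r -> ~ A (x + r *: v).

(** The linear span of the smallest face of [A] containing [x], translated to
    the origin. *)
Definition face_direction (R : realType) (V : lmodType R) (A : set V) (x : V) :
    set V :=
  [set v | exists2 e : R, 0 < e & forall s, `|s| <= e -> A (x + s *: v)].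

Lemma face_directionZ (R : realType) (V : lmodType R) (A : set V) (x v : V)
    (a : R) : face_direction A x v -> face_direction A x (a *: v).
Proof.
move=> [e e0 Av]; exists (e / (`|a| + 1)); first by rewrite divr_gt0 ?ltr_wpDl.
move=> s; rewrite ler_pdivlMr ?ltr_wpDl// => le_s; rewrite scalerA; apply: Av.
by rewrite normrM (le_trans _ le_s)// ler_wpM2l ?lerDl.
Qed.

Lemma face_directionD (R : realType) (V : lmodType R) (A : set V) (x u v : V) :
    convex_set A -> face_direction A x u -> face_direction A x v ->
  face_direction A x (u + v).
Proof.
move=> cvxA [d d0 Au] [e e0 Av].
exists (Num.min d e / 2); first by rewrite divr_gt0// lt_min d0 e0.
move=> s; rewrite ler_pdivlMr// le_min => /andP[sd se].
have -> : x + s *: (u + v) =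
    2^-1 *: (x + (s * 2) *: u) + (1 - 2^-1) *: (x + (s * 2) *: v).
  rewrite !scalerDr !scalerA addrACA -scalerDl; congr (_ + (_ *: _ + _ *: _)).
  - by rewrite addrC subrK scale1r.
  - by field.
  - by field.
apply: cvxA; [apply: Au|apply: Av|lra]; by rewrite normrM [`|2|]ger0_norm.
Qed.

(** If [x] lies strictly between [y] and [z], then [y - z] is a face direction
    at [x], so only a degenerate segment is possible. *)
Lemma extreme_point_of_face_direction (R : realType) (V : lmodType R)
    (A : set V) (x : V) : convex_set A -> A x ->
    (forall v, face_direction A x v -> v = 0) -> extreme_points A x.
Proof.
move=> cvxA Ax dir0; split=> // y z t Ay Az /andP[t0 t1] xE.
suff yz : y = z by rewrite xE yz -scalerDl addrC subrK scale1r.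
apply/eqP; rewrite -subr_eq0; apply/eqP/dir0.
exists (Num.min t (1 - t)); first by rewrite lt_min t0 subr_gt0.
move=> s; rewrite le_min => /andP[]; rewrite !ler_norml => /andP[s1 _] /andP[_ s2].
have -> : x + s *: (y - z) = (t + s) *: y + (1 - (t + s)) *: z.
  by rewrite xE scalerBr addrACA -scalerDl -scalerBl opprD addrA.
by apply: cvxA => //; lra.
Qed.

(** The minimal face of a point shrinks on the way to its boundary. Starting
    from [x], move along a face direction [v] as far as [A] allows, in both
    senses. Each endpoint lies in the minimal face of [x], hence its face
    directions are face directions at [x], but [v] is no longer one of them; so
    the dimension has dropped, and [x] is between the two endpoints. No
    supporting hyperplane is involved. *)
Lemma minkowski (R : realType) (V : vectType R) (A : set V) :
    convex_set A -> has_exit_points A ->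
  A `<=` convex_combinations (extreme_points A).
Proof.
move=> cvxA exitA x Ax.
(* The dimension of the set of face directions, measured by the subspaces that
   it contains so that it never has to be built as a subspace itself. *)
have : forall U : {vspace V}, (forall u, u \in U -> face_direction A x u) ->
    (\dim U <= \dim {:V})%N.
  by move=> U _; exact/dimvS/subvf.
elim: (\dim {:V}) x Ax => [|n IH] x Ax dimx.
  apply/convex_combinations1/extreme_point_of_face_direction => // v dirv.
  apply/eqP; suff : (\dim <[v]> <= 0)%N by rewrite dim_vline leqn0 eqb0 negbK.
  by apply: dimx => _ /vlineP[k ->]; exact: face_directionZ.
have [dir0|] := pselect (forall v, face_direction A x v -> v = 0).
  exact/convex_combinations1/extreme_point_of_face_direction.
move=> /existsNP[v /not_implyP[dirv /eqP v0]].
have endpoint u : face_direction A x u -> u != 0 ->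
    exists s : R, [/\ 0 < s, A (x + s *: u) &
      ~ face_direction A (x + s *: u) u].
  move=> [e e0 Au] u0; have [s As smax] := exitA x u Ax u0.
  exists s; split=> //.
    apply: (lt_le_trans e0); rewrite leNgt; apply/negP => /smax; apply.
    by apply: Au; rewrite gtr0_norm.
  move=> [d d0 /(_ d)]; rewrite gtr0_norm// lexx -addrA -scalerDl => /(_ isT).
  by apply: smax; rewrite ltrDl.
have conv_endpoint u s s' : face_direction A x u -> 0 < s -> 0 < s' ->
    u != 0 -> A (x + s *: u) -> A (x - s' *: u) ->
    ~ face_direction A (x + s *: u) u ->
    convex_combinations (extreme_points A) (x + s *: u).
  move=> diru s0 s'0 u0 As As' ndir; apply: IH => // U dirU.
  set z := x + s *: u in As ndir dirU.
  (* x is a strict convex combination of z and x - s' u, with weight l on z: a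
     small segment around z contracts to a small segment around x. *)
  have dirz w : face_direction A z w -> face_direction A x w.
    move=> [d d0 Aw]; pose l := s' / (s + s').
    have l0 : 0 < l by rewrite divr_gt0 ?addr_gt0.
    exists (l * d); first exact: mulr_gt0.
    move=> r le_r.
    have -> : x + r *: w =
        l *: (z + (r / l) *: w) + (1 - l) *: (x - s' *: u).
      rewrite /z !scalerDr scalerN !scalerA.
      rewrite [l * (r / l)]mulrC divfK ?gt_eqF//.
      have -> : (1 - l) * s' = l * s.
        by rewrite /l; field; rewrite gt_eqF ?addr_gt0.
      rewrite [RHS]addrACA [l *: x + _ + _]addrAC -scalerDl
        [l + _]addrC subrK scale1r.
      by rewrite -[RHS]addrA [(_ *: u) + _]addrCA subrr addr0 addrC.
    apply: cvxA => //.
      apply: Aw.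
      by rewrite normrM normfV (gtr0_norm l0) ler_pdivrMr// mulrC.
    by rewrite ltW//= ler_pdivrMr ?addr_gt0// mul1r lerDr ltW.
  have Uv : (U :&: <[u]>)%VS = 0%VS.
    apply/eqP; rewrite -subv0; apply/subvP => w.
    rewrite memv_cap memv0 => /andP[Uw /vlineP[k wE]].
    apply/eqP; move: Uw; rewrite wE => Uw.
    have [->|k0] := eqVneq k 0; first by rewrite scale0r.
    exfalso; apply: ndir; rewrite -[u](scalerK k0).
    exact/face_directionZ/dirU.
  have := dimx (U + <[u]>)%VS.
  rewrite dimv_disjoint_sum// dim_vline u0 addn1; apply.
  move=> _ /memv_addP[a Ua [_ /vlineP[k ->] ->]].
  by apply: face_directionD => //; [exact/dirz/dirU|exact: face_directionZ].
have dirNv : face_direction A x (- v).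
  by rewrite -scaleN1r; exact: face_directionZ.
have [s [s0 As ns]] := endpoint v dirv v0.
have Nv0 : - v != 0 by rewrite oppr_eq0.
have [r [r0 Ar nr]] := endpoint (- v) dirNv Nv0.
have xs := conv_endpoint v s r dirv s0 r0 v0 As.
have xr := conv_endpoint (- v) r s dirNv r0 s0 Nv0 Ar.
rewrite -scalerN in xs; rewrite scalerN opprK in xr.
have -> : x =
    (r / (s + r)) *: (x + s *: v) + (1 - r / (s + r)) *: (x + r *: - v).
  rewrite !scalerDr !scalerA addrACA -scalerDl [_ + (1 - _)]addrC subrK scale1r.
  rewrite scalerN -scalerBl.
  rewrite (_ : _ - _ = 0) ?scale0r ?addr0//.
  by field; rewrite gt_eqF ?addr_gt0.
apply: convex_combinations_segment; [|exact: xs|exact: xr].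
by rewrite ler_pdivrMr ?addr_gt0// mul1r lerDr !ltW ?divr_gt0 ?addr_gt0.
Qed.

(** * Balls cut out by linear maps *)

(** Unit balls of the space and of its dual are both of this shape: for the
    first take the identity map alone, for the second the evaluations at the
    points of the unit ball. *)
Lemma joint_ball_convex (R : realType) (V : lmodType R) (W : normedModType R)
    (I : Type) (P : set I) (phi : I -> V -> W) :
    (forall i, linear (phi i)) ->
  convex_set [set a | forall i, P i -> `|phi i a| <= 1].
Proof.
move=> lphi x y t Ax Ay /andP[t0 t1] i Pi; have := lphi i t x ((1 - t) *: y).
have phiZ a u : phi i (a *: u) = a *: phi i u.
  have phi0 : phi i 0 = 0.
    apply: (addrI (phi i 0)).
    by rewrite addr0 -{1}[phi i 0]scale1r -lphi scale1r addr0.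
  by rewrite -[X in phi i X]addr0 lphi phi0 addr0.
rewrite /= phiZ => ->; apply: (le_trans (ler_normD _ _)).
rewrite !normrZ (ger0_norm t0) ger0_norm ?subr_ge0//.
have := ler_wpM2l t0 (Ax i Pi).
have s0 : 0 <= 1 - t by rewrite subr_ge0.
have := ler_wpM2l s0 (Ay i Pi).
lra.
Qed.

(** The exit parameter is a supremum: the set of admissible parameters is bounded
    as soon as one [phi i] does not kill the direction, and the supremum is
    itself admissible because each [phi i] is Lipschitz along the line. *)
Lemma joint_ball_has_exit_points (R : realType) (V : lmodType R)
    (W : normedModType R) (I : Type) (P : set I) (phi : I -> V -> W) :
    (forall i, linear (phi i)) ->
    (forall v, v != 0 -> exists2 i, P i & phi i v != 0) ->
  has_exit_points [set a | forall i, P i -> `|phi i a| <= 1].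
Proof.
move=> lphi inj x v Ax v0; set A := [set a | _].
have phiE i s : phi i (x + s *: v) = phi i x + s *: phi i v.
  by rewrite addrC lphi addrC.
pose S := [set s | A (x + s *: v)].
have S0 : S 0 by rewrite /S /= scale0r addr0.
have ubS : has_ubound S.
  have [i Pi phi_v0] := inj v v0.
  exists (2 / `|phi i v|) => s /(_ i Pi); rewrite phiE => le1.
  rewrite ler_pdivlMr ?normr_gt0//.
  apply: (@le_trans _ _ (`|s *: phi i v|)).
    by rewrite normrZ ler_wpM2r// ler_norm.
  rewrite -[s *: _](addKr (phi i x)) (le_trans (ler_normD _ _))// normrN.
  by rewrite [2](_ : _ = 1 + 1)// lerD// Ax.
exists (sup S) => [i Pi|r lt_r Ar]; last first.
  by have := ub_le_sup ubS Ar; rewrite leNgt lt_r.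
rewrite phiE; apply/ler_addgt0Pl => e e0.
pose d := e / (`|phi i v| + 1).
have d0 : 0 < d by rewrite divr_gt0 ?ltr_wpDl.
have [s Ss lt_s] := sup_adherent d0 (conj (ex_intro _ 0 S0) ubS).
have le_s : s <= sup S by exact: ub_le_sup.
have -> : phi i x + sup S *: phi i v =
    (sup S - s) *: phi i v + (phi i x + s *: phi i v).
  by rewrite scalerBl addrA [_ + phi i x]addrC addrA subrK.
apply: (le_trans (ler_normD _ _)).
apply: lerD; last by rewrite -phiE; exact: Ss.
rewrite normrZ ger0_norm ?subr_ge0//.
apply: (@le_trans _ _ (d * (`|phi i v| + 1))); last first.
  by rewrite divfK// gt_eqF ?ltr_wpDl.
by apply: ler_pM; rewrite ?subr_ge0 ?lerDl//; lra.
Qed.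

Lemma minkowski_joint_ball (R : realType) (V : vectType R)
    (W : normedModType R) (I : Type) (P : set I) (phi : I -> V -> W) :
    (forall i, linear (phi i)) ->
    (forall v, v != 0 -> exists2 i, P i & phi i v != 0) ->
  let A := [set a | forall i, P i -> `|phi i a| <= 1] in
  A `<=` convex_combinations (extreme_points A).
Proof.
move=> lphi inj A; apply: minkowski; first exact: joint_ball_convex.
exact: joint_ball_has_exit_points.
Qed.

Lemma minkowski_unit_ball (R : realType) (Y : finDimBanachType R) :
  unit_ball Y `<=` convex_combinations (extreme_points (unit_ball Y)).
Proof.
have -> : unit_ball Y = [set a | forall i : unit, setT i -> `|idfun a| <= 1].
  by apply/seteqP; split=> y /= => [h _ _ //|]; exact.
by apply: minkowski_joint_ball => [_ a x y //|v v0]; exists tt.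
Qed.

Definition dual_ball (R : realType) (X : finDimBanachType R) :
    set 'Hom(X, R^o) :=
  [set f | forall x, unit_ball X x -> `|f x : R| <= 1].
Arguments dual_ball {R} X.

Lemma lfun_neq0 (K : fieldType) (U V : vectType K) (f : 'Hom(U, V)) :
  f != 0 -> exists x, f x != 0.
Proof.
move=> f0; apply: contrapT => /forallNP h; move/eqP: f0; apply.
apply/lfunP => x; rewrite zero_lfunE; apply/eqP.
by have /negP := h x; rewrite negbK.
Qed.

Lemma minkowski_dual_ball (R : realType) (X : finDimBanachType R) :
  dual_ball X `<=` convex_combinations (extreme_points (dual_ball X)).
Proof.
pose ev (x : X) (f : 'Hom(X, R^o)) : R^o := f x.
apply: (@minkowski_joint_ball R _ R^o _ (unit_ball X) ev).
  by move=> x a f g; rewrite /ev add_lfunE scale_lfunE.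
move=> f /lfun_neq0[x fx]; have x0 : x != 0.
  by apply: contraNneq fx => ->; rewrite linear0.
exists (`|x|^-1 *: x).
  by rewrite /unit_ball/= normrZ normfV normr_id mulVf// normr_eq0.
by rewrite /ev linearZ scaler_eq0 negb_or fx invr_eq0 normr_eq0 x0.
Qed.

(** * Extreme functionals of a polyhedral space *)

Lemma separating_functional (K : fieldType) (V : vectType K) (v : V) :
  v != 0 -> exists g : 'Hom(V, K^o), g v != 0.
Proof.
move=> v0; apply: contrapT => /forallNP h; move/eqP: v0; apply.
rewrite (coord_vbasis (memvf v)) big1// => i _.
have /negP := h (linfun (coord (vbasis {:V}) i : V -> K^o)).
by rewrite negbK lfunE => /eqP ->; rewrite scale0r.
Qed.

(** In a symmetric set, [0] is the midpoint of [a] and [- a]. *)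
Lemma extreme_point_neq0 (R : realType) (V : lmodType R) (A : set V) (a x : V) :
  (forall z, A z -> A (- z)) -> A a -> a != 0 -> extreme_points A x -> x != 0.
Proof.
move=> symA Aa /eqP a0 [Ax extx]; apply/eqP => x0; apply: a0.
have [||||a0 _] // := extx a (- a) 2^-1; [exact: symA|lra| |by rewrite a0].
by rewrite x0 scalerN -scalerBl (_ : _ - _ = 0) ?scale0r//; lra.
Qed.

Lemma unit_ballN (R : realType) (V : normedModType R) (x : V) :
  unit_ball V x -> unit_ball V (- x).
Proof. by rewrite /unit_ball/= normrN. Qed.

Lemma dual_ballN (R : realType) (X : finDimBanachType R) (f : 'Hom(X, R^o)) :
  dual_ball X f -> dual_ball X (- f).
Proof. by move=> Df x Bx; rewrite opp_lfunE normrN; exact: Df. Qed.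

(** The supremum of a functional over the unit ball is attained at extreme
    points, by Minkowski's theorem; symmetry of the ball gives the absolute
    value. *)
Lemma dual_ball_of_extreme_points (R : realType) (X : finDimBanachType R)
    (f : 'Hom(X, R^o)) :
    (forall e, extreme_points (unit_ball X) e -> (f e : R) <= 1) ->
  dual_ball X f.
Proof.
move=> f_le1; have le1 x : unit_ball X x -> (f x : R) <= 1.
  move=> /minkowski_unit_ball[n [c [a [c0 c1 Aa ->]]]].
  rewrite linear_sum -c1; apply: ler_sum => i _.
  by rewrite linearZ -[leRHS]mulr1 ler_wpM2l// f_le1.
move=> x Bx; rewrite ler_norml le1// andbT lerNl -linearN le1//.
exact: unit_ballN.
Qed.

Lemma uniform_radius (R : realType) (T : eqType) (s : seq T) (P : T -> R -> Prop) :
    (forall e, e \in s ->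
      exists2 d : R, 0 < d & forall r, `|r| <= d -> P e r) ->
  exists2 d : R, 0 < d & forall e, e \in s -> forall r, `|r| <= d -> P e r.
Proof.
elim: s => [|a s IH] h; first by exists 1.
have [d d0 Pa] := h a (mem_head _ _).
have [|b b0 Ps] := IH; first by move=> e es; apply: h; rewrite inE es orbT.
exists (Num.min d b); first by rewrite lt_min d0.
move=> e; rewrite inE => /orP[/eqP ->|es] r; rewrite le_min => /andP[rd rb].
  exact: Pa.
exact: Ps.
Qed.

(** Here finiteness of the set of extreme points is essential. If the extreme
    points where [f] equals 1 spanned a proper subspace, a nonzero functional
    [g] would vanish on them; the finitely many other extreme points leave some
    slack, so [f + d g] and [f - d g] stay in the dual ball for a small [d],
    and [f] is not extreme. *)
Lemma extreme_functional_norming_span (R : realType) (X : finDimBanachType R)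
    (f : 'Hom(X, R^o)) : polyhedral X -> extreme_points (dual_ball X) f ->
  exists act : seq X, [/\ forall e, e \in act -> unit_ball X e,
    forall e, e \in act -> f e = 1 & <<act>>%VS = fullv].
Proof.
move=> /finite_seqP[E extE] [Df extf].
have EE e : e \in E -> extreme_points (unit_ball X) e by move=> ?; rewrite extE.
pose act := [seq e <- E | f e == 1].
exists act; split=> [e|e|].
- by rewrite mem_filter => /andP[_ /EE[]].
- by rewrite mem_filter => /andP[/eqP].
apply/eqP; rewrite eqEsubv subvf/=; apply/subvP => v _.
have [pv0|] := eqVneq (v - projv <<act>> v) 0.
  by rewrite (subr0_eq pv0) memv_proj.
move=> /separating_functional[k k0]; exfalso.
(* g kills the span of act, since the projection is the identity there, but
   g v = k (v - projv v) is not zero. *)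
pose g : 'Hom(X, R^o) := (k \o (\1 - projv <<act>>))%VF.
have gE x : g x = k (x - projv <<act>> x).
  by rewrite comp_lfunE add_lfunE opp_lfunE id_lfunE.
have gact e : e \in act -> g e = 0.
  by move=> es; rewrite gE projv_id ?memv_span// subrr linear0.
have [e eE|d d0 dP] :=
    @uniform_radius R _ E (fun e r => (f e : R) + r * (g e : R) <= 1).
  have fe : (f e : R) <= 1.
    by have := Df e (EE e eE).1; rewrite ler_norml => /andP[].
  have [fe1|fe1] := eqVneq (f e : R) 1.
    exists 1 => // r _; rewrite gact ?mulr0 ?addr0//.
    by rewrite mem_filter eE fe1 eqxx.
  exists ((1 - (f e : R)) / (`|g e : R| + 1)).
    by rewrite divr_gt0 ?subr_gt0 ?ltr_wpDl// lt_neqAle fe1.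
  move=> r; rewrite ler_pdivlMr ?ltr_wpDl// => le_r.
  rewrite -lerBrDl (le_trans _ le_r)// (le_trans (ler_norm _))// normrM.
  by rewrite ler_wpM2l ?lerDl.
have Dg r : `|r| <= d -> dual_ball X (f + r *: g).
  move=> rd; apply: dual_ball_of_extreme_points => e; rewrite extE /= => eE.
  by rewrite add_lfunE scale_lfunE; exact: dP.
have [||||fE _] := extf (f + d *: g) (f + - d *: g) 2^-1.
- by apply: Dg; rewrite gtr0_norm.
- by apply: Dg; rewrite normrN gtr0_norm.
- lra.
- rewrite !scalerDr addrACA -scalerDl [_ + (1 - _)]addrC subrK scale1r.
  by rewrite !scalerA -scalerDl [X in X *: g](_ : _ = 0) ?scale0r ?addr0//; lra.
have /eqP : d *: g = 0 by apply: (addrI f); rewrite fE addr0.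
rewrite scaler_eq0 gt_eqF//= => /eqP g0.
by move: k0; rewrite -gE g0 zero_lfunE eqxx.
Qed.

(** * Rank one operators *)

Definition tensor_fun (R : realType) (X Y : vectType R) (f : 'Hom(X, R^o))
  (y : Y) (x : X) : Y := (f x : R) *: y.

Lemma tensor_fun_is_linear (R : realType) (X Y : vectType R)
  (f : 'Hom(X, R^o)) (y : Y) : linear (tensor_fun f y).
Proof.
by move=> a u v; rewrite /tensor_fun linearP scalerDl scalerA.
Qed.

HB.instance Definition _ (R : realType) (X Y : vectType R) (f : 'Hom(X, R^o))
    (y : Y) :=
  GRing.isLinear.Build R X Y *:%R (tensor_fun f y) (tensor_fun_is_linear f y).

Definition tensor (R : realType) (X Y : vectType R) (f : 'Hom(X, R^o)) (y : Y) :
  'Hom(X, Y) := linfun (tensor_fun f y).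

Lemma tensorE (R : realType) (X Y : vectType R) (f : 'Hom(X, R^o)) (y : Y)
  (x : X) : tensor f y x = (f x : R) *: y.
Proof. by rewrite lfunE. Qed.

Lemma opnorm_le1P (R : realType) (X Y : finDimBanachType R) (T : 'Hom(X, Y)) :
  (opnorm T <= 1)%E <-> forall x, unit_ball X x -> unit_ball Y (T x).
Proof.
split=> [T1 x Bx|T1].
  rewrite /unit_ball/= -lee_fin (le_trans _ T1)//.
  by apply: ereal_sup_ubound; exists x.
by apply: ge_ereal_sup => _ [x Bx <-]; rewrite lee_fin; exact: T1.
Qed.

(** Write [tensor f y] as a proper convex combination of contractions [S] and
    [S']. At every norming vector [e] of [f] it takes the extreme value [y], which
    forces [S e = S' e = y]. Such vectors span the domain, so both operators
    are determined. *)
Lemma tensor_extreme (R : realType) (X Y : finDimBanachType R)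
    (f : 'Hom(X, R^o)) (y : Y) : polyhedral X ->
    extreme_points (dual_ball X) f -> extreme_points (unit_ball Y) y ->
  extreme_contractions X Y (tensor f y).
Proof.
move=> polyX extf [By exty]; split.
  apply/opnorm_le1P => x Bx; rewrite /unit_ball/= tensorE normrZ.
  by rewrite mulr_ile1// extf.1.
move=> S S' t /opnorm_le1P S1 /opnorm_le1P S'1 t01 TE.
have [s [sB fs spans]] := extreme_functional_norming_span polyX extf.
have agree (L : 'Hom(X, Y)) : (forall e, e \in s -> L e = y) -> L = tensor f y.
  move=> Ls; apply/lfunP => x; apply/eqP; rewrite -subr_eq0 -opp_lfunE -add_lfunE.
  rewrite -memv_ker; apply: subvP (memvf x); rewrite -spans.
  apply/span_subvP => e es; rewrite memv_ker add_lfunE opp_lfunE tensorE.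
  by rewrite Ls// fs// scale1r subrr.
have eval e : e \in s -> S e = y /\ S' e = y.
  move=> es; apply: (exty _ _ t) => //; [exact/S1/sB|exact/S'1/sB|].
  by rewrite -!scale_lfunE -add_lfunE -TE tensorE fs// scale1r.
by split; apply: agree => e /eval[].
Qed.

Lemma rank_tensor (R : realType) (X Y : finDimBanachType R)
    (f : 'Hom(X, R^o)) (y : Y) : f != 0 -> y != 0 -> rank (tensor f y) = 1%N.
Proof.
move=> /lfun_neq0[x fx] y0; have -> : 1%N = \dim <[y]> by rewrite dim_vline y0.
congr (\dim _); apply/eqP; rewrite eqEsubv; apply/andP; split; apply/subvP => z.
  by move=> /memv_imgP[u _ ->]; rewrite tensorE memvZ// memv_line.
move=> /vlineP[k ->]; apply/memv_imgP; exists ((k / (f x : R)) *: x).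
  exact: memvf.
rewrite tensorE linearZ; congr (_ *: _).
by rewrite -[RHS]/(k / (f x : R) * (f x : R)) divfK.
Qed.

(** Normalizing [y] moves the whole norm of the operator into [f]. *)
Lemma rank1_tensor (R : realType) (X Y : finDimBanachType R) (T : 'Hom(X, Y)) :
  rank T = 1%N -> exists (f : 'Hom(X, R^o)) (y : Y), `|y| = 1 /\ T = tensor f y.
Proof.
move=> rT; pose z := vpick (limg T).
have z0 : z != 0 by rewrite vpick0 -dimv_eq0 -/(rank T) rT.
have limgE : <[z]>%VS = limg T.
  by apply/eqP; rewrite eqEdim -memvE memv_pick -/(rank T) rT dim_vline z0.
have nz0 : `|z| != 0 by rewrite normr_eq0.
have [g gz] := separating_functional z0.
exists ((`|z| / (g z : R)) *: (g \o T)%VF), (`|z|^-1 *: z).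
split; first by rewrite normrZ normfV normr_id mulVf.
apply/lfunP => x; rewrite tensorE scale_lfunE comp_lfunE.
have /vlineP[k ->] : T x \in <[z]>%VS by rewrite limgE memv_img ?memvf.
rewrite [g (_ *: _)]linearZ !scalerA; congr (_ *: _).
rewrite -[RHS]/(`|z| / (g z : R) * k * (g z : R) / `|z|).
by field; rewrite nz0 gz.
Qed.

Lemma tensor_sum (R : realType) (X Y : finDimBanachType R) (n m : nat)
    (c : 'I_n -> R) (f : 'I_n -> 'Hom(X, R^o)) (d : 'I_m -> R) (y : 'I_m -> Y) :
  tensor (\sum_i c i *: f i) (\sum_j d j *: y j) =
  \sum_p (c p.1 * d p.2) *: tensor (f p.1) (y p.2).
Proof.
apply/lfunP => x; rewrite tensorE !sum_lfunE scaler_suml.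
under eq_bigr do rewrite scaler_sumr.
rewrite pair_bigA; apply: eq_bigr => p _.
rewrite !scale_lfunE tensorE !scalerA; congr (_ *: _).
by rewrite -mulrA mulrAC mulrA.
Qed.

Theorem corollary2p7 (R : realType) (X Y : finDimBanachType R)
    (dimX : \dim {:X} = 2%N) (polyX : polyhedral X) (polyY : polyhedral Y) :
  rank_invariant_KMP X Y 1.
Proof.
move=> T nT rT; have [f [y [y1 TE]]] := rank1_tensor rT.
have By : unit_ball Y y by rewrite /unit_ball/= y1.
have y0 : y != 0 by rewrite -normr_eq0 y1 oner_eq0.
have Df : dual_ball X f.
  move=> x Bx; have /opnorm_le1P : (opnorm T <= 1)%E by rewrite nT.
  by move=> /(_ x Bx); rewrite /unit_ball/= TE tensorE normrZ y1 mulr1.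
have f0 : f != 0.
  apply: contra_eq_neq rT => f0; rewrite TE f0 (_ : tensor _ _ = 0).
    by rewrite /rank lim0g dimv0.
  by apply/lfunP => x; rewrite tensorE !zero_lfunE scale0r.
rewrite {}TE.
have [n [c [g [c_ge0 c1 extg ->]]]] := minkowski_dual_ball Df.
have [m [d [z [d_ge0 d1 extz ->]]]] := minkowski_unit_ball By.
rewrite tensor_sum; apply: convex_combinationsI => [p||p].
- exact: mulr_ge0.
- by rewrite -(pair_bigA _ (fun i j => c i * d j)) -big_distrlr/= c1 d1 mulr1.
split; first exact: tensor_extreme.
apply: rank_tensor.
  exact: extreme_point_neq0 (@dual_ballN R X) Df f0 (extg _).
exact: extreme_point_neq0 (@unit_ballN R Y) By y0 (extz _).
Qed.
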